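(* Let $X$ be a smooth projective toric variety whose nef cone is unimodular (with respect to $\mathrm{Pic}(X)$) with primitive generators $L_1,\dots,L_\rho$. If $$0\ne D=b_1L_1+\cdots+b_\rho L_\rho\in\mathrm{Nef}(X)\cap\mathrm{Pic}(X),$$ then $b_i\in\mathbb Z_{\ge0}$ for all $i$ and $$\tau_X(D;\mathbb Z)=\tau_X(D;\mathbb Q)=b_1+\cdots+b_\rho.$$ In particular, $\delta_X(D)=0$ for every nonzero nef integral class $D$.
   Context: All toric varieties are over an algebraically closed field. Gongyo indices. For a smooth projective toric variety $X$, a nonzero class $D\in\mathrm{Nef}(X)\cap\mathrm{Pic}(X)$ and $\mathbb K\in\{\mathbb Z,\mathbb Q\}$, put $$\tau_X(D;\mathbb K)=\sup\Big\{\sum_{i=1}^r a_i\ \Big|\ D=\sum_{i=1}^r a_iD_i,\ 0\ne D_i\in\mathrm{Nef}(X)\cap\mathrm{Pic}(X),\ a_i\in\mathbb K_{>0}\Big\}$$ (for $\mathbb K=\mathbb Q$ the equality is in $\mathrm{Pic}(X)\otimes\mathbb Q$), and $\delta_X(D)=\tau_X(D;\mathbb Q)-\tau_X(D;\mathbb Z)$. A full-dimensional strongly convex rational polyhedral cone $C\subset L_{\mathbb R}$, $L$ a lattice, is unimodular with respect to $L$ if its primitive extremal-ray generators form a $\mathbb Z$-basis of $L$. *)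

(* Defs.v *)
From HB Require Import structures.
From mathcomp Require Import all_boot all_order all_algebra.
From mathcomp Require Import generic_quotient ring_quotient.
From mathcomp Require Import all_classical all_reals ereal.

Set Implicit Arguments.
Unset Strict Implicit.
Unset Printing Implicit Defensive.

Import Order.TTheory GRing.Theory Num.Theory.
Local Open Scope classical_set_scope.
Local Open Scope ring_scope.
Local Open Scope quotient_scope.

(* The combinatorial data of a simplicial fan in N = Z^fan_dim.  Row i of
   [fan_ray] is the primitive generator u_i of the i-th ray; a cone is recorded
   as the set of (indices of) its rays.  M is the group of column vectors, and
   <m, u_i> is the i-th entry of [fan_ray X *m m]. *)
Record fan := Fan {
  fan_dim : nat;
  fan_nrays : nat;
  fan_ray : 'M[int]_(fan_nrays, fan_dim);
  fan_cones : {set {set 'I_fan_nrays}} }.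

(* The rays with coefficients in an arbitrary ring: the matrix of the map
   div : M (x) A -> (+)_i A D_i, div(chi^m) = sum_i <m, u_i> D_i. *)
Definition raymx (A : pzRingType) (X : fan) : 'M[A]_(fan_nrays X, fan_dim X) :=
  map_mx intr (fan_ray X).

Definition fan_cone (R : realType) (X : fan) (s : {set 'I_(fan_nrays X)}) :
    set 'rV[R]_(fan_dim X) :=
  [set x | exists c : 'rV[R]_(fan_nrays X),
     [/\ forall i, 0 <= c 0 i,
         forall i, i \notin s -> c 0 i = 0 &
         x = c *m raymx R X]].
Arguments fan_cone R {X} s.

(* Faces of a simplicial cone correspond to subsets of its rays, so the third
   clause says that two cones meet along their common face. *)
Definition is_fan (R : realType) (X : fan) : Prop :=
  [/\ forall i, [set i]%SET \in fan_cones X,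
      forall s t : {set 'I_(fan_nrays X)},
        t \subset s -> s \in fan_cones X -> t \in fan_cones X &
      forall s t : {set 'I_(fan_nrays X)},
        s \in fan_cones X -> t \in fan_cones X ->
        fan_cone R s `&` fan_cone R t = fan_cone R (s :&: t)%SET].

(* The ray generators of every cone are part of a Z-basis of N. *)
Definition smooth_fan (X : fan) : Prop :=
  forall s : {set 'I_(fan_nrays X)}, s \in fan_cones X ->
  exists (B : 'M[int]_(fan_dim X)) (f : 'I_(fan_nrays X) -> 'I_(fan_dim X)),
    [/\ B \in unitmx, {in s &, injective f} &
        forall i, i \in s -> row i (fan_ray X) = row (f i) B].

Definition complete_fan (R : realType) (X : fan) : Prop :=
  forall x : 'rV[R]_(fan_dim X), exists2 s, s \in fan_cones X & fan_cone R s x.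

(* There is an ample divisor sum_i a_i D_i, that is, one with strictly convex
   support function: its local datum m_s on each maximal cone s satisfies
   <m_s, u_i> = - a_i for i in s and <m_s, u_i> > - a_i for i not in s. *)
Definition polarized_fan (X : fan) : Prop :=
  exists a : 'cV[int]_(fan_nrays X),
  forall s : {set 'I_(fan_nrays X)}, s \in fan_cones X -> #|s| = fan_dim X ->
  exists m : 'cV[int]_(fan_dim X), forall i,
    if i \in s then (fan_ray X *m m) i 0 = - a i 0
    else - a i 0 < (fan_ray X *m m) i 0.

(* The smooth projective toric variety of X over an algebraically closed field
   is represented by its fan; [R] only serves as the field of real numbers. *)
Definition smooth_projective_toric (R : realType) (X : fan) : Prop :=
  [/\ is_fan R X, smooth_fan X, complete_fan R X & polarized_fan X].

Definition principal (A : comNzRingType) (X : fan) :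
    {pred 'cV[A]_(fan_nrays X)} :=
  fun D => `[< exists m : 'cV[A]_(fan_dim X), D = raymx A X *m m >].
Arguments principal : clear implicits.

Fact principal_zmod_closed (A : comNzRingType) (X : fan) :
  zmod_closed (principal A X).
Proof.
split; first by apply/asboolP; exists 0; rewrite mulmx0.
move=> _ _ /asboolP[m ->] /asboolP[m' ->].
by apply/asboolP; exists (m - m'); rewrite mulmxBr.
Qed.

HB.instance Definition _ (A : comNzRingType) (X : fan) :=
  GRing.isZmodClosed.Build _ (principal A X) (principal_zmod_closed A X).

(* Pic(X) (x) A, as torus-invariant divisors with coefficients in A modulo
   div(M (x) A); Pic(X) itself is the case A = int. *)
Definition pic (A : comNzRingType) (X : fan) := Quotient.quot (principal A X).
Arguments pic : clear implicits.

HB.instance Definition _ (A : comNzRingType) (X : fan) :=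
  GRing.Zmodule.on (pic A X).

Definition divclass (A : comNzRingType) (X : fan) (D : 'cV[A]_(fan_nrays X)) :
  pic A X := \pi_(Quotient.quot (principal A X)) D.

Lemma divclass_eq (A : comNzRingType) (X : fan) (D D' : 'cV[A]_(fan_nrays X)) :
  divclass D = divclass D' <->
  exists m : 'cV[A]_(fan_dim X), D - D' = raymx A X *m m.
Proof.
by split=> [/eqP|H]; [rewrite /divclass -Quotient.idealrBE => /asboolP|
  apply/eqP; rewrite /divclass -Quotient.idealrBE; apply/asboolP].
Qed.

Lemma divclass_repr (A : comNzRingType) (X : fan) (x : pic A X) :
  divclass (repr x) = x.
Proof. exact: reprK. Qed.

Lemma divclassD (A : comNzRingType) (X : fan) (D D' : 'cV[A]_(fan_nrays X)) :
  divclass (D + D') = divclass D + divclass D'.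
Proof. by rewrite /divclass Quotient.pi_add. Qed.

Definition pic_scale (A : comNzRingType) (X : fan) (c : A) (x : pic A X) :
  pic A X := divclass (c *: repr x).

Lemma pic_scaleE (A : comNzRingType) (X : fan) (c : A)
    (D : 'cV[A]_(fan_nrays X)) :
  pic_scale c (divclass D) = divclass (c *: D).
Proof.
apply/divclass_eq.
have /divclass_eq[m Dm] := divclass_repr (divclass D).
by exists (c *: m); rewrite -scalerBr Dm scalemxAr.
Qed.

Fact pic_scaleA (A : comNzRingType) (X : fan) (a b : A) (x : pic A X) :
  pic_scale a (pic_scale b x) = pic_scale (a * b) x.
Proof. by rewrite -[x]divclass_repr !pic_scaleE scalerA. Qed.

Fact pic_scale1 (A : comNzRingType) (X : fan) :
  left_id 1 (@pic_scale A X).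
Proof. by move=> x; rewrite -[x]divclass_repr pic_scaleE scale1r. Qed.

Fact pic_scaleDr (A : comNzRingType) (X : fan) :
  right_distributive (@pic_scale A X) +%R.
Proof.
move=> c x y; rewrite -[x]divclass_repr -[y]divclass_repr.
by rewrite -divclassD !pic_scaleE -divclassD scalerDr.
Qed.

Fact pic_scaleDl (A : comNzRingType) (X : fan) (x : pic A X) :
  {morph (@pic_scale A X)^~ x : a b / a + b}.
Proof.
by move=> a b; rewrite -[x]divclass_repr !pic_scaleE -divclassD scalerDl.
Qed.

HB.instance Definition _ (A : comNzRingType) (X : fan) :=
  GRing.Zmodule_isLmodule.Build A (pic A X) (@pic_scaleA A X)
    (@pic_scale1 A X) (@pic_scaleDr A X) (@pic_scaleDl A X).

(* The canonical map Pic(X) -> Pic(X) (x) A. *)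
Definition pic_map (A : comNzRingType) (X : fan) (x : pic int X) : pic A X :=
  divclass (map_mx intr (repr x)).
Arguments pic_map A {X} x.

Lemma pic_mapE (A : comNzRingType) (X : fan) (D : 'cV[int]_(fan_nrays X)) :
  pic_map A (divclass D) = divclass (map_mx intr D).
Proof.
apply/divclass_eq.
have /divclass_eq[m Dm] := divclass_repr (divclass D).
exists (map_mx intr m); rewrite -map_mxB Dm map_mxM; congr (_ *m _).
by apply/matrixP=> i j; rewrite !mxE intz.
Qed.

(* F is a finitely generated extension of k of transcendence degree 1: for some
   t transcendental over k, every x in F is a k(t)-combination of the finitely
   many e_j (the common denominator p(t) is moved to the left-hand side). *)
Definition is_function_field (k F : fieldType) (iota : {rmorphism k -> F}) :
    Prop :=
  exists t : F,
    (forall p : {poly k}, (map_poly iota p).[t] = 0 -> p = 0) /\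
    exists (d : nat) (e : 'I_d -> F), forall x : F,
    exists (p : {poly k}) (q : 'I_d -> {poly k}), p != 0 /\
      (map_poly iota p).[t] * x = \sum_j (map_poly iota (q j)).[t] * e j.

(* The normalized discrete valuations of F/k, i.e. the closed points of the
   smooth projective curve with function field F.  The junk value v(0) = 0 makes
   the function v unique. *)
Definition is_place (k F : fieldType) (iota : {rmorphism k -> F}) :
    set (F -> int) :=
  [set v | [/\ v 0 = 0,
    {in [pred x | x != 0] &, {morph v : x y / x * y >-> x + y}},
    forall x y, x != 0 -> y != 0 -> x + y != 0 ->
      Num.min (v x) (v y) <= v (x + y),
    forall c : k, v (iota c) = 0 &
    exists2 x, x != 0 & v x = 1]].

(* A morphism f : C -> X from a smooth projective curve over k, in Cox's
   description of the functor of points of a smooth toric variety: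
   - C is given by its function field;
   - [cm_div i] is a divisor E_i on C with f^* O(D_i) = O_C(E_i);
   - [cm_sec i] is the section of O_C(E_i) induced by the i-th Cox coordinate,
     as a rational function;
   - the isomorphisms (x)_i O_C(E_i)^<m, u_i> = O_C are multiplication by g
     (they can be chosen multiplicative in m since M is free);
   - at each point of C the vanishing coordinates span a cone of the fan. *)
Record curve_map (k : closedFieldType) (X : fan) := CurveMap {
  cm_field : fieldType;
  cm_const : {rmorphism k -> cm_field};
  cm_function_field : is_function_field cm_const;
  cm_div : 'I_(fan_nrays X) -> (cm_field -> int) -> int;
  cm_sec : 'I_(fan_nrays X) -> cm_field;
  cm_div_finite : forall i,
    finite_set [set v | is_place cm_const v /\ cm_div i v != 0];
  cm_sec_global : forall i v, is_place cm_const v -> cm_sec i != 0 ->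
    0 <= v (cm_sec i) + cm_div i v;
  cm_trivial : forall m : 'cV[int]_(fan_dim X), exists2 g : cm_field, g != 0 &
    forall v, is_place cm_const v ->
      v g = \sum_i (fan_ray X *m m) i 0 * cm_div i v;
  cm_nondegenerate : forall v, is_place cm_const v ->
    [set i | (cm_sec i == 0) || (0 < v (cm_sec i) + cm_div i v)]%SET
      \in fan_cones X }.
Arguments cm_div {k X} c i v : rename.
Arguments cm_sec {k X} c i : rename.

(* deg f^* O(D_i); residue degrees are 1 since k is algebraically closed. *)
Definition ray_degree (k : closedFieldType) (X : fan) (f : curve_map k X)
    (i : 'I_(fan_nrays X)) : int :=
  \sum_(v \in is_place (cm_const f)) cm_div f i v.

(* deg f^* D for an R-divisor D. *)
Definition curve_degree (R : realType) (k : closedFieldType) (X : fan)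
    (D : 'cV[R]_(fan_nrays X)) (f : curve_map k X) : R :=
  \sum_i D i 0 * (ray_degree f i)%:~R.

(* deg f^* D only depends on the class of D, as principal divisors on curves
   have degree 0. *)
Definition nef_cone (R : realType) (k : closedFieldType) (X : fan) :
    set (pic R X) :=
  [set x | forall D : 'cV[R]_(fan_nrays X), divclass D = x ->
     forall f : curve_map k X, 0 <= curve_degree D f].
Arguments nef_cone : clear implicits.

Definition integral_nef (R : realType) (k : closedFieldType) (X : fan)
    (D : pic int X) : Prop :=
  nef_cone R k X (pic_map R D).
Arguments integral_nef R k {X} D.

(* Below L is a lattice, V = L (x) R, and iota : L -> V is the canonical map;
   (V, iota) will be (Pic(X) (x) R, pic_map R). *)

Definition rational_polyhedral (R : realType) (L : zmodType) (V : lmodType R)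
    (iota : L -> V) (C : set V) : Prop :=
  exists (d : nat) (g : 'I_d -> L),
    C = [set x | exists2 c : 'I_d -> R, forall j, 0 <= c j &
                 x = \sum_j c j *: iota (g j)].

Definition strongly_convex (R : realType) (V : lmodType R) (C : set V) : Prop :=
  forall x, C x -> C (- x) -> x = 0.

Definition full_dimensional (R : realType) (V : lmodType R) (C : set V) :
    Prop :=
  forall x, exists y z, [/\ C y, C z & x = y - z].

Definition extremal_ray (R : realType) (V : lmodType R) (C : set V) (x : V) :
    Prop :=
  [/\ C x, x != 0 &
      forall y z, C y -> C z -> y + z = x -> exists2 t, 0 <= t & y = t *: x].

Definition primitive (L : zmodType) (l : L) : Prop :=
  l != 0 /\ forall (d : nat) (l' : L), l = l' *+ d -> d = 1%N.

(* g_1, ..., g_rho lists without repetition the primitive generators of the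
   extremal rays of C. *)
Definition primitive_generators (R : realType) (L : zmodType) (V : lmodType R)
    (iota : L -> V) (C : set V) (rho : nat) (g : 'I_rho -> L) : Prop :=
  injective g /\
  forall l, (exists i, g i = l) <-> primitive l /\ extremal_ray C (iota l).

Definition Z_basis (L : zmodType) (rho : nat) (g : 'I_rho -> L) : Prop :=
  forall l, exists! c : {ffun 'I_rho -> int}, l = \sum_i g i *~ c i.

Definition unimodular (R : realType) (L : zmodType) (V : lmodType R)
    (iota : L -> V) (C : set V) : Prop :=
  [/\ rational_polyhedral iota C, strongly_convex C, full_dimensional C &
      exists (rho : nat) (g : 'I_rho -> L),
        primitive_generators iota C g /\ Z_basis g].

(* The suprema are taken in the extended reals, so no boundedness is built in. *)
Definition tauZ (R : realType) (k : closedFieldType) (X : fan)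
    (D : pic int X) : \bar R :=
  ereal_sup [set x | exists (r : nat) (a : 'I_r -> int) (E : 'I_r -> pic int X),
    [/\ forall i, 0 < a i,
        forall i, E i != 0 /\ integral_nef R k (E i),
        D = \sum_i E i *~ a i &
        x = ((\sum_i a i)%:~R)%:E]].
Arguments tauZ R k {X} D.

Definition tauQ (R : realType) (k : closedFieldType) (X : fan)
    (D : pic int X) : \bar R :=
  ereal_sup [set x | exists (r : nat) (a : 'I_r -> rat) (E : 'I_r -> pic int X),
    [/\ forall i, 0 < a i,
        forall i, E i != 0 /\ integral_nef R k (E i),
        pic_map rat D = \sum_i a i *: pic_map rat (E i) &
        x = (ratr (\sum_i a i))%:E]].
Arguments tauQ R k {X} D.

Definition delta (R : realType) (k : closedFieldType) (X : fan)
    (D : pic int X) : \bar R :=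
  (tauQ R k D - tauZ R k D)%E.
Arguments delta R k {X} D.

(* Main.v *)
Require Import Defs.
From HB Require Import structures.
From mathcomp Require Import all_boot all_order all_algebra.
From mathcomp Require Import all_classical all_reals ereal.

Import Order.TTheory GRing.Theory Num.Theory.
Local Open Scope ring_scope.

(** In the Z-basis L_1, ..., L_rho a class on X is a vector of integer
    coordinates, and unimodularity makes the nef classes exactly those with
    nonnegative coordinates.  So every nonzero nef integral class has degree
    (sum of coordinates) at least 1.  The degree being additive, a decomposition
    D = sum_j a_j E_j with rational a_j > 0 satisfies
      deg D = sum_j a_j deg E_j >= sum_j a_j,
    that is, tau_Q <= deg D; the integral decomposition D = sum_i b_i L_i,
    restricted to the indices with b_i > 0, attains this value, and
    tau_Z <= tau_Q because integral decompositions are rational ones.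

    Two points need an argument.

    Unimodularity says that the primitive generators of the extremal rays are a
    basis of Pic(X); that they also generate the nef cone is a case of the
    Minkowski theorem.  For a finitely generated strongly convex cone it
    suffices to take a generating subfamily of least size: its members are
    extremal ([extremal_subfamily]).  The generators being integral, each of
    them is a positive multiple of a primitive one ([Z_basis_primitive]), which
    gives [primitive_generators_cone].

    Coordinates have to survive the base change from Z to R and to Q, where
    Pic(X) (x) A is a quotient of divisors with coefficients in A.  A functional
    on Pic(X) is a row of integers that kills the principal divisors
    div(chi^m), hence, by linearity, all of div(M (x) A); it therefore extends
    to Pic(X) (x) A ([extend_functional]).  Applied to the coordinates, this
    shows that the L_i stay linearly independent over A. *)

Set Implicit Arguments.
Unset Strict Implicit.
Unset Printing Implicit Defensive.

(** * Finitely generated cones *)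

Definition cone (R : realType) (V : lmodType R) (d : nat) (v : 'I_d -> V) :
    set V :=
  [set x | exists2 c : 'I_d -> R, forall j, 0 <= c j &
           x = \sum_j c j *: v j]%classic.

Lemma cone_gen (R : realType) (V : lmodType R) (d : nat) (v : 'I_d -> V) j :
  cone v (v j).
Proof.
exists (fun i => (i == j)%:R) => [i|]; first exact: ler0n.
rewrite (bigD1 j) //= eqxx scale1r big1 ?addr0 // => i /negPf ->.
by rewrite scale0r.
Qed.

Lemma coneZ (R : realType) (V : lmodType R) (d : nat) (v : 'I_d -> V) t x :
  0 <= t -> cone v x -> cone v (t *: x).
Proof.
move=> t0 [c c0 ->]; exists (fun j => t * c j) => [j|]; first exact: mulr_ge0.
by rewrite scaler_sumr; apply: eq_bigr => j _; rewrite scalerA.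
Qed.

Lemma coneD (R : realType) (V : lmodType R) (d : nat) (v : 'I_d -> V) x y :
  cone v x -> cone v y -> cone v (x + y).
Proof.
move=> [a a0 ->] [b b0 ->]; exists (fun j => a j + b j) => [j|].
  exact: addr_ge0.
by rewrite -big_split; apply: eq_bigr => j _; rewrite scalerDl.
Qed.

Lemma cone_sum (R : realType) (V : lmodType R) (d : nat) (v : 'I_d -> V)
    (I : finType) (P : pred I) (F : I -> V) :
  (forall i, P i -> cone v (F i)) -> cone v (\sum_(i | P i) F i).
Proof.
move=> vF; apply: (big_ind (cone v)) => //; last exact: coneD.
by exists (fun=> 0) => //; rewrite big1 // => j _; rewrite scale0r.
Qed.

Lemma cone_sub (R : realType) (V : lmodType R) (d e : nat)
    (v : 'I_d -> V) (w : 'I_e -> V) :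
  (forall j, cone w (v j)) -> (cone v `<=` cone w)%classic.
Proof.
by move=> wv x [c c0 ->]; apply: cone_sum => j _; apply: coneZ.
Qed.

(** In a generating subfamily of least size no member v_j is a nonnegative
    combination of the others.  If v_j = y + z in the cone, expand y + z as
    sum_i s_i v_i, so that (1 - s_j) v_j = sum_(i != j) s_i v_i.  Then s_j < 1
    contradicts minimality and s_j > 1 strong convexity; so s_j = 1, and strong
    convexity kills every term with i != j, leaving y proportional to v_j. *)
Lemma extremal_subfamily (R : realType) (V : lmodType R) (d : nat)
    (v : 'I_d -> V) :
  strongly_convex (cone v) ->
  exists (e : nat) (f : 'I_e -> 'I_d),
    cone (v \o f) = cone v /\
    forall j, extremal_ray (cone v) (v (f j)).
Proof.
move=> cvx; pose P n :=
  `[< exists f : 'I_n -> 'I_d, cone (v \o f) = cone v >].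
have exP : exists n, P n by exists d; apply/asboolP; exists id.
case: (ex_minnP exP) => n /asboolP[f ef] nmin; exists n, f; split=> // j.
(* Irredundancy: otherwise f \o lift j would be a shorter generating family. *)
have irr (w : 'I_n -> R) : (forall i, 0 <= w i) ->
    v (f j) <> \sum_(i | i != j) w i *: v (f i).
  move=> w0 vj; case: n f j {ef} (ef) nmin w w0 vj => [f []//|n] f j ef nmin.
  move=> w w0 vj; suff /nmin : P n by rewrite ltnn.
  have lf i : i != j -> cone (v \o (f \o lift j)) (v (f i)).
    rewrite eq_sym => /unlift_some[i' -> _].
    exact: (cone_gen (v \o (f \o lift j))).
  apply/asboolP; exists (f \o lift j); rewrite -ef; apply/seteqP; split.
    apply: cone_sub => i; exact: (cone_gen (v \o f) (lift j i)).
  apply: cone_sub => i; have [->|/lf//] := eqVneq i j.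
  by rewrite /= vj; apply: cone_sum => i' /lf; apply: coneZ.
have K i : cone v (v (f i)) by apply: cone_gen.
have vj0 : v (f j) != 0.
  apply/eqP => vj0; apply: (irr (fun=> 0)) => //.
  by rewrite vj0 big1 // => i _; rewrite scale0r.
split=> // y z; rewrite -ef => -[a a0 ->] [b b0 ->] /=.
pose s i := a i + b i; have s0 i : 0 <= s i by apply: addr_ge0.
rewrite -big_split => /= eqj.
have rest : (1 - s j) *: v (f j) = \sum_(i | i != j) s i *: v (f i).
  rewrite scalerBl scale1r -{1}eqj (bigD1 j) //= -scalerDl addrAC subrr add0r.
  by apply: eq_bigr => i _; rewrite scalerDl.
have [sj|sj|sj] := ltgtP (s j) 1.
- have sj0 : 1 - s j != 0 by rewrite subr_eq0 gt_eqF.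
  exfalso; apply: (irr (fun i => (1 - s j)^-1 * s i)) => [i|].
    by rewrite mulr_ge0 // invr_ge0 subr_ge0 ltW.
  under eq_bigr do rewrite -scalerA.
  by rewrite -scaler_sumr -rest scalerA mulVf // scale1r.
- have : (s j - 1) *: v (f j) = 0.
    apply: cvx; first by apply: coneZ => //; rewrite subr_ge0 ltW.
    rewrite -scaleNr opprB rest; apply: cone_sum => i _; exact: coneZ.
  by move/eqP; rewrite scaler_eq0 (negPf vj0) subr_eq0 gt_eqF.
exists (a j) => //; rewrite (bigD1 j) //= big1 ?addr0 // => i ij.
apply: cvx; first exact: coneZ.
(* This uses that sum_(l != j) s_l v_l = 0. *)
have -> : - (a i *: v (f i)) =
    b i *: v (f i) + \sum_(l | (l != j) && (l != i)) s l *: v (f l).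
  apply/eqP; rewrite -subr_eq0 -opprD oppr_eq0 addrA -scalerDl; apply/eqP.
  by rewrite -(bigD1 i (F := fun l => s l *: v (f l))) // -rest sj subrr scale0r.
by apply: coneD; [exact: coneZ|apply: cone_sum => l _; exact: coneZ].
Qed.

(** * Lattice bases and primitive generators *)

Lemma Z_basis_coord (L : zmodType) (rho : nat) (g : 'I_rho -> L) :
  Z_basis g -> exists c : 'I_rho -> {additive L -> int},
    (forall l, l = \sum_i g i *~ c i l) /\
    (forall i j, c i (g j) = (i == j)%:R).
Proof.
move=> /choice[c cP].
have ce l : l = \sum_i g i *~ c l i by case: (cP l).
have cu l (d : 'I_rho -> int) : l = \sum_i g i *~ d i -> forall i, c l i = d i.
  case: (cP l) => _ + ld i => /(_ [ffun i => d i]) -> //; first by rewrite ffunE.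
  by rewrite {1}ld; apply: eq_bigr => j _; rewrite ffunE.
have cB i : zmod_morphism (fun l => c l i).
  move=> x y; apply: (cu _ (fun i => c x i - c y i)).
  rewrite {1}(ce x) {1}(ce y) -sumrB; apply: eq_bigr => j _.
  by rewrite mulrzBr.
pose A i := GRing.isZmodMorphism.Build _ _ _ (cB i).
pose C i : {additive L -> int} := HB.pack (fun l => c l i) (A i).
exists C; split=> [l|i j]; first exact: ce.
apply: (cu _ (fun i => (i == j)%:R)); rewrite (bigD1 j) //= eqxx big1 ?addr0 //.
by move=> l /negPf ->.
Qed.

(** Multiplicities of l divide each of its coordinates, hence are bounded by a
    nonzero one; for the largest multiplicity the quotient is primitive. *)
Lemma Z_basis_primitive (L : zmodType) (rho : nat) (g : 'I_rho -> L) (l : L) :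
  Z_basis g -> l != 0 -> exists (l' : L) (d : nat), primitive l' /\ l = l' *+ d.
Proof.
move=> /Z_basis_coord[c [cE _]] l0.
have [i ci] : exists i, c i l != 0.
  apply/existsP; apply: contraNT l0; rewrite negb_exists => /forallP c0.
  by rewrite (cE l) big1 // => i _; have:= c0 i; rewrite negbK => /eqP->.
pose P d := `[< exists l', l = l' *+ d >].
have Pmax d : P d -> (d <= `|c i l|)%N.
  move=> /asboolP[l' ll']; move: ci; rewrite ll' raddfMn -mulr_natr abszM.
  rewrite mulf_eq0 negb_or -absz_gt0 => /andP[ci _].
  by rewrite natz /= leq_pmull.
have exP : exists d, P d by exists 1%N; apply/asboolP; exists l.
case: (ex_maxnP exP Pmax) => d /asboolP[l' ll'] dmax; exists l', d; split=> //.
have d0 : (0 < d)%N by rewrite lt0n; apply: contraNneq l0 => d0; rewrite ll' d0.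
split=> [|e m l'm]; first by apply: contraNneq l0 => l'0; rewrite ll' l'0 mul0rn.
have e0 : (0 < e)%N.
  by rewrite lt0n; apply: contraNneq l0 => e0; rewrite ll' l'm e0 mul0rn.
have : (e * d <= d)%N by apply: dmax; apply/asboolP; exists m; rewrite mulrnA -l'm.
by rewrite -[X in (_ <= X)%N]mul1n leq_pmul2r // => e1; apply/eqP; rewrite eqn_leq e1.
Qed.

(** The extremal rays through the integral vectors provided by
    [extremal_subfamily] also contain primitive vectors, which must then occur
    among the g i. *)
Lemma primitive_generators_cone (R : realType) (L : zmodType) (V : lmodType R)
    (iota : {additive L -> V}) (C : set V) (rho : nat) (g : 'I_rho -> L) :
  rational_polyhedral iota C -> strongly_convex C ->
  primitive_generators iota C g -> Z_basis g -> C = cone (iota \o g).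
Proof.
move=> [d [h CE]] cvx [_ gP] gZ.
have {}CE : C = cone (iota \o h) by [].
apply/seteqP; split; last first.
  by rewrite CE; apply: cone_sub => j; rewrite -CE; case: (proj1 (gP (g j)));
    [exists j|move=> _ []].
have [e [f [fE fext]]] : exists e (f : 'I_e -> 'I_d),
    cone ((iota \o h) \o f) = C /\
    forall j, extremal_ray C ((iota \o h) (f j)).
  by rewrite CE; apply: extremal_subfamily; rewrite -CE.
rewrite -fE; apply: cone_sub => j.
have [/= Cj j0 jext] := fext j.
have h0 : h (f j) != 0.
  by apply: contraNneq j0 => ->; rewrite raddf0.
have [l [m [lprim lE]]] := Z_basis_primitive gZ h0.
have iE : iota (h (f j)) = m%:R *: iota l by rewrite lE raddfMn scaler_nat.
have m0 : m%:R != 0 :> R.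
  by apply: contraNneq j0 => m0; rewrite iE m0 scale0r.
have [i gi] : exists i, g i = l.
  apply/gP; split=> //; have lE' : iota l = m%:R^-1 *: iota (h (f j)).
    by rewrite iE scalerA mulVf // scale1r.
  split.
  - by rewrite lE' CE; apply: coneZ; rewrite ?invr_ge0 ?ler0n // -CE.
  - by apply: contraNneq j0 => l0; rewrite iE l0 scaler0.
  - move=> y z Cy Cz yz; case: (jext (m%:R *: y) (m%:R *: z)).
    + by rewrite CE; apply: coneZ; rewrite ?ler0n // -CE.
    + by rewrite CE; apply: coneZ; rewrite ?ler0n // -CE.
    + by rewrite -scalerDr yz iE.
    + move=> t t0; rewrite iE scalerA mulrC -scalerA => /(scalerI m0) yE.
      by exists t.
by rewrite /= iE -gi; apply: coneZ => //; exact: (cone_gen (iota \o g)).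
Qed.

(** Two lists of the primitive generators of the same cone differ by a bijection
    of their index sets.  This carries the basis property from the list whose
    existence is part of unimodularity to any other one. *)
Lemma primitive_generators_Z_basis (R : realType) (L : zmodType)
    (V : lmodType R) (iota : L -> V) (C : set V) (rho sigma : nat)
    (g : 'I_rho -> L) (h : 'I_sigma -> L) :
  primitive_generators iota C g -> primitive_generators iota C h ->
  Z_basis g -> Z_basis h.
Proof.
move=> [gI gP] [hI hP] gZ.
have /choice[u uE] j : exists i, g i = h j.
  by apply/gP/hP; exists j.
have /choice[v vE] i : exists j, h j = g i.
  by apply/hP/gP; exists i.
have uK : cancel u v by move=> j; apply: hI; rewrite vE uE.
have vK : cancel v u by move=> i; apply: gI; rewrite uE vE.
have ub : bijective u by exists v.
move=> l; have [c [lE cu]] := gZ l; exists [ffun j => c (u j)]; split.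
  rewrite {1}lE (reindex u) /=; last exact: onW_bij.
  by apply: eq_bigr => j _; rewrite ffunE uE.
move=> c' lE'; have -> : c = [ffun i => c' (v i)].
  apply: cu; rewrite {1}lE' (reindex v) /=; last by apply: onW_bij; exists u.
  by apply: eq_bigr => i _; rewrite ffunE vE.
by apply/ffunP => j; rewrite !ffunE uK.
Qed.

(** * Base change of the Picard group *)

Lemma pic_map_zmod_morphism (A : comNzRingType) (X : fan) :
  zmod_morphism (@pic_map A X).
Proof.
move=> x y; rewrite -[x]divclass_repr -[y]divclass_repr.
have divB (B : comNzRingType) (D E : 'cV[B]_(fan_nrays X)) :
    divclass D - divclass E = divclass (D - E).
  by apply/eqP; rewrite subr_eq -divclassD subrK.
by rewrite divB !pic_mapE divB map_mxB.
Qed.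

HB.instance Definition _ (A : comNzRingType) (X : fan) :=
  GRing.isZmodMorphism.Build (pic int X) (pic A X) (@pic_map A X)
    (@pic_map_zmod_morphism A X).

(** The extension sends sum_j D_j [D_j] to sum_j D_j psi([D_j]).  It vanishes on
    div(M (x) A) because it does so on div(chi^m) for m in a basis of M. *)
Lemma extend_functional (A : comNzRingType) (X : fan)
    (psi : {additive pic int X -> int}) :
  exists phi : {linear pic A X -> A^o},
    forall x, phi (pic_map A x) = (psi x)%:~R.
Proof.
pose n := fan_nrays X.
pose e (j : 'I_n) : int := psi (divclass (delta_mx j 0)).
have psiE (D : 'cV[int]_n) : psi (divclass D) = \sum_j D j 0 * e j.
  have divM : {morph @divclass int X : E F / E + F >-> E + F}.
    exact: divclassD.
  have div0 : divclass (0 : 'cV[int]_n) = 0 :> pic int X.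
    by apply: (addIr (divclass (0 : 'cV[int]_n))); rewrite -divclassD !add0r.
  rewrite {1}[D]matrix_sum_delta.
  under eq_bigr do rewrite big_ord1.
  rewrite (big_morph _ divM div0) raddf_sum; apply: eq_bigr => j _.
  rewrite -pic_scaleE -[LHS]/(psi (D j 0 *: (divclass (delta_mx j 0) : pic int X))).
  by rewrite -[D j 0]intz scaler_int raddfMz mulrzl.
pose S (D : 'cV[A]_n) : A := \sum_j D j 0 * (e j)%:~R.
have S_lin a D E : S (a *: D + E) = a * S D + S E.
  rewrite /S mulr_sumr -big_split; apply: eq_bigr => j _.
  by rewrite !mxE mulrDl mulrA.
(* The l-th basis vector of M gives an integral relation between the e j. *)
have S0 m : S (raymx A X *m m) = 0.
  have row0 l : \sum_j raymx A X j l * (e j)%:~R = 0.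
    have : psi (divclass (fan_ray X *m delta_mx l 0)) = 0.
      have -> : divclass (fan_ray X *m delta_mx l 0) = divclass 0 :> pic int X.
        apply/divclass_eq; exists (delta_mx l 0); rewrite subr0; congr (_ *m _).
        by apply/matrixP => i j; rewrite mxE intz.
      by rewrite psiE big1 // => j _; rewrite mxE mul0r.
    rewrite psiE -colE => /(congr1 (fun z : int => z%:~R : A)).
    rewrite mulr0z rmorph_sum /= => row0; rewrite -[RHS]row0.
    by apply: eq_bigr => j _; rewrite !mxE intrM.
  rewrite /S; under eq_bigr do rewrite mxE mulr_suml.
  rewrite exchange_big big1 //= => l _.
  under eq_bigr do rewrite mulrAC.
  by rewrite -mulr_suml row0 mul0r.
have S_class D E : divclass D = divclass E :> pic A X -> S D = S E.
  move=> /divclass_eq[m DE].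
  have -> : D = 1 *: (D - E) + E by rewrite scale1r subrK.
  by rewrite S_lin DE S0 mulr0 add0r.
pose phi (x : pic A X) : A^o := S (repr x).
have phiE D : phi (divclass D) = S D by apply: S_class; exact: divclass_repr.
have phi_lin : linear phi.
  move=> a x y; rewrite -[x]divclass_repr -[y]divclass_repr.
  rewrite -[a *: divclass _]/(pic_scale a (divclass (repr x))).
  by rewrite pic_scaleE -divclassD !phiE S_lin.
pose lin := GRing.isLinear.Build _ _ _ _ phi phi_lin.
pose phiL : {linear pic A X -> A^o} := HB.pack phi lin.
exists phiL => x.
rewrite -[x]divclass_repr pic_mapE [LHS]phiE psiE rmorph_sum.
by apply: eq_bigr => j _; rewrite mxE [RHS]rmorphM.
Qed.

(** * Nef classes in coordinates *)

(** The coordinates are defined on Pic(X) only; nonnegativity of the integer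
    c i D is read off from a real expression of D in the nef cone, which is
    possible because the functional c i extends to Pic(X) (x) R. *)
Lemma nef_coordinates (R : realType) (k : closedFieldType) (X : fan)
    (rho : nat) (L : 'I_rho -> pic int X) :
  unimodular (@pic_map R X) (nef_cone R k X) ->
  primitive_generators (@pic_map R X) (nef_cone R k X) L ->
  exists c : 'I_rho -> {additive pic int X -> int},
    [/\ forall D, D = \sum_i L i *~ c i D,
        forall D, integral_nef R k D -> forall i, 0 <= c i D &
        forall (D : pic int X) (b : 'I_rho -> R),
          pic_map R D = \sum_i b i *: pic_map R (L i) ->
          forall i, b i = (c i D)%:~R].
Proof.
move=> [poly cvx _ [sigma [g [gP gZ]]]] LP.
have LZ := primitive_generators_Z_basis gP LP gZ.
have nefE := primitive_generators_cone (iota := @pic_map R X) poly cvx LP LZ.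
have [c [cE cL]] := Z_basis_coord LZ; exists c.
have uniq_b D (b : 'I_rho -> R) : pic_map R D = \sum_i b i *: pic_map R (L i) ->
    forall i, b i = (c i D)%:~R.
  move=> DE i; have [phi phiE] := extend_functional R (c i).
  rewrite -phiE DE linear_sum (bigD1 i) //= big1 => [|j ji].
    by rewrite addr0 linearZ_LR phiE cL eqxx [RHS]mulr1.
  by rewrite linearZ_LR phiE cL eq_sym (negPf ji) [LHS]mulr0.
split=> // D Dnef i; move: (Dnef); rewrite /integral_nef nefE => -[b b0 DE].
by rewrite -(ler0z R) -(uniq_b D b DE).
Qed.

Unset Implicit Arguments.

Theorem proposition2p9 (R : realType) (k : closedFieldType) (X : fan)
    (hX : smooth_projective_toric R X)
    (hnef : unimodular (@pic_map R X) (nef_cone R k X))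
    (rho : nat) (L : 'I_rho -> pic int X)
    (hL : primitive_generators (@pic_map R X) (nef_cone R k X) L) :
  (forall (D : pic int X) (b : 'I_rho -> R),
     D != 0 -> integral_nef R k D ->
     pic_map R D = \sum_i b i *: pic_map R (L i) ->
     (forall i, b i \is a Num.nat) /\
     tauZ R k D = (\sum_i b i)%:E /\
     tauQ R k D = (\sum_i b i)%:E) /\
  (forall D : pic int X, D != 0 -> integral_nef R k D -> delta R k D = 0%E).
Proof.
have [c [cE c_ge0 c_real]] := nef_coordinates hnef hL.
pose deg (D : pic int X) := \sum_i c i D.
have deg_ge1 D : D != 0 -> integral_nef R k D -> 1 <= deg D.
  move=> D0 /c_ge0 Dnef; rewrite -gtz0_ge1 lt_neqAle eq_sym sumr_ge0 // andbT.
  apply: contraNneq D0 => /eqP; rewrite psumr_eq0 // => /allP cD.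
  rewrite (cE D) big1 // => i _.
  by have /eqP -> := cD i (mem_index_enum i).
(* The degree, extended to Pic(X) (x) Q, bounds every rational decomposition. *)
have tauQ_le D : (tauQ R k D <= (deg D)%:~R%:E)%E.
  apply: ge_ereal_sup => _ [r [a [E [a0 Enef DE ->]]]].
  rewrite lee_fin -[(deg D)%:~R](ratr_int R) ler_rat.
  have -> : (deg D)%:~R = \sum_j a j * (deg (E j))%:~R :> rat.
    rewrite /deg rmorph_sum /=; under [RHS]eq_bigr do rewrite rmorph_sum mulr_sumr.
    rewrite exchange_big; apply: eq_bigr => i _ /=.
    have [phi phiE] := extend_functional rat (c i).
    rewrite -phiE DE linear_sum; apply: eq_bigr => j _.
    by rewrite linearZ_LR phiE.
  apply: ler_sum => j _; rewrite -[X in X <= _]mulr1 ler_pM2l //.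
  have [Ej0 Ejnef] := Enef j.
  by have := deg_ge1 _ Ej0 Ejnef; rewrite -(ler_int rat).
have tauZ_le_tauQ (D : pic int X) : (tauZ R k D <= tauQ R k D)%E.
  apply: ge_ereal_sup => _ [r [a [E [a0 Enef DE ->]]]].
  apply: ereal_sup_ubound; exists r, (fun j => (a j)%:~R), E; split=> //.
  - by move=> j; rewrite ltr0z.
  - rewrite {1}DE raddf_sum; apply: eq_bigr => j _.
    by rewrite raddfMz scaler_int.
  - by rewrite -rmorph_sum /= ratr_int.
have Lnef i : integral_nef R k (L i).
  by case: hL => _ /(_ (L i))[/(_ (ex_intro _ i erefl))[_ []]].
have L0 i : L i != 0.
  by case: hL => _ /(_ (L i))[/(_ (ex_intro _ i erefl))[[]]].
(* The coefficients of a decomposition must be positive, whence the restriction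
   to the support S of D. *)
have tauZ_ge D : integral_nef R k D -> ((deg D)%:~R%:E <= tauZ R k D)%E.
  move=> /c_ge0 Dnef; pose S := [pred i | 0 < c i D].
  have S0 i : i \notin S -> c i D = 0.
    by rewrite inE lt_neqAle Dnef andbT negbK => /eqP.
  apply: ereal_sup_ubound; exists #|S|.
  exists (fun j => c (enum_val j) D), (fun j => L (enum_val j)); split=> //.
  - by move=> j; have := enum_valP j; rewrite inE.
  - rewrite {1}(cE D) (bigID (mem S)) /= [X in _ + X]big1 ?addr0.
      exact: (big_enum_val (fun i => L i *~ c i D)).
    by move=> i /S0 ->.
  - congr ((_%:~R)%:E); rewrite /deg (bigID (mem S)) /= [X in _ + X]big1 ?addr0.
      exact: (big_enum_val (fun i => c i D)).
    by move=> i /S0.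
have tauE D : integral_nef R k D ->
    tauZ R k D = (deg D)%:~R%:E /\ tauQ R k D = (deg D)%:~R%:E.
  move=> /tauZ_ge Dge; split; apply/eqP; rewrite eq_le ?tauQ_le ?Dge ?andbT /=.
    exact: (le_trans (tauZ_le_tauQ D) (tauQ_le D)).
  exact: (le_trans Dge (tauZ_le_tauQ D)).
split=> [D b D0 Dnef /c_real bE|D D0 Dnef]; last first.
  by rewrite /delta; have [-> ->] := tauE D Dnef; rewrite -EFinB subrr.
split=> [i|]; first by rewrite bE natrEint rpred_int ler0z c_ge0.
have -> : \sum_i b i = (deg D)%:~R; last exact: tauE.
by rewrite rmorph_sum; apply: eq_bigr => i _; rewrite bE.
Qed.
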